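(* Consider Algorithm IRETR run with $\gamma=1$ and accuracy level $\varepsilon_g>0$. Assume that: (1) $h:\mathbb N\to\mathbb R$ is monotone, strictly decreasing, with $h(1)>0$ and $h(N)=0$; put $\underline h=h(N-1)$; (2) $\{x_k\}\subset\Omega$ for some compact set $\Omega\subset\mathbb R^n$; (3) the gradients $\nabla\phi_i$, $1\le i\le N$, are Lipschitz continuous, with a common constant $L$, on the segments $[x_k,x_k+p_k]$ for all $k\ge0$ and all trial steps $p_k$ generated in the repetitions of Steps 2--5; (4) there is $\kappa_B>0$ such that $\|B_{k+1}\|\le\kappa_B$ for all $k$. Then there exists a constant $\nu_4>0$ such that Algorithm IRETR needs at most $$\lceil\nu_4\,\varepsilon_g^{-2}\rceil+1$$ iterations (to satisfy its stopping criterion), provided that $\underline h^{-1}=\mathcal O(\varepsilon_g^{-2})$ and $$\Delta_0\ge\zeta_1\max\left\{\Gamma\varepsilon_g,\ \sqrt{\underline h/\mu}\right\},\qquad \Gamma=\min\left\{\frac1\beta,\ \frac{\tau\,\underline\theta\,(1-\eta)}{2(\kappa_T+\mu)}\right\}.$$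
   Context: Problem. Let $N,n\ge 1$ be integers and $\phi_1,\dots,\phi_N:\mathbb R^n\to\mathbb R$ continuously differentiable. For a nonempty $I_M\subseteq\{1,\dots,N\}$ with $|I_M|=M$ put $f_M(x)=\frac1M\sum_{i\in I_M}\phi_i(x)$; $f_N$ is the full average, to be minimized over $\mathbb R^n$. $\|\cdot\|$ is the Euclidean (operator 2-) norm. $h:\mathbb N\to\mathbb R$ measures infeasibility with respect to the constraint $M=N$. Algorithm IRETR. Data: $x_0\in\mathbb R^n$, an integer $N_0\in(0,N]$, $\theta_0\in(0,1)$, $\Delta_0>0$, $0<\zeta_1<1<\zeta_2$, $\gamma\in(0,1]$, $r,\eta,\tau\in(0,1)$, $\mu\in[0,1)$, $\varepsilon_g\ge0$. Step 0. Set $k=0$, $\mathcal T_0=0$, $\Delta_0^{(0)}=\Delta_0$. Step 1. If $N_k<N$, find an integer $\widetilde N_{k+1}$ with $N_k<\widetilde N_{k+1}\le N$ and $h(\widetilde N_{k+1})\le r\,h(N_k)$. If $N_k=N$, set $\widetilde N_{k+1}=N$. Step 2. Choose an integer $1\le N_{k+1}\le\widetilde N_{k+1}$ with $h(N_{k+1})-h(\widetilde N_{k+1})\le\mu(\Delta_k^{(\mathcal T_k)})^{1+\gamma}$ and a sample $I_{N_{k+1}}$. If $N_k=N$ and $\|\nabla f_{N_{k+1}}(x_k)\|\le\varepsilon_g$, stop. Build the model $m_k(p)=f_{N_{k+1}}(x_k)+\nabla f_{N_{k+1}}(x_k)^Tp+\frac12p^TB_{k+1}p$ with $B_{k+1}\in\mathbb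 R^{n\times n}$ symmetric (possibly zero). Find $p_k$ with $\|p_k\|\le\Delta_k^{(\mathcal T_k)}$ and $m_k(0)-m_k(p_k)\ge\tau(m_k(0)-m_k(p_k^C))$, where the Cauchy step $p_k^C$ minimizes $m_k$ over $\{p=-t\nabla f_{N_{k+1}}(x_k):\ t>0,\ \|p\|\le\Delta_k^{(\mathcal T_k)}\}$. Step 3. If $N_k=N$, $N_{k+1}<N$ and $f_N(x_k)-m_k(p_k)<\tau(m_k(0)-m_k(p_k^C))$, set $\Delta_k^{(\mathcal T_k+1)}=\zeta_1\Delta_k^{(\mathcal T_k)}$, $\mathcal T_k=\mathcal T_k+1$ and repeat Step 2. Step 4. Set $\theta_{k+1}=\theta_k$ if $\mathrm{Pred}_k(\theta_k)\ge\eta(h(N_k)-h(\widetilde N_{k+1}))$; otherwise $\theta_{k+1}=\dfrac{(1-\eta)(h(N_k)-h(\widetilde N_{k+1}))}{m_k(p_k)-f_{N_k}(x_k)+h(N_k)-h(\widetilde N_{k+1})}$. Step 5. If $\mathrm{Ared}_k(\theta_{k+1})\ge\eta\,\mathrm{Pred}_k(\theta_{k+1})$, set $x_{k+1}=x_k+p_k$, $\Delta_k=\Delta_k^{(\mathcal T_k)}$, choose $\Delta_{k+1}^{(0)}\in[\Delta_k,\zeta_2\Delta_k]$, set $k=k+1$, $\mathcal T_k=0$ and go to Step 1. Otherwise set $\Delta_k^{(\mathcal T_k+1)}=\zeta_1\Delta_k^{(\mathcal T_k)}$, $\mathcal T_k=\mathcal T_k+1$ and go to Step 2. Here $\mathrm{Pred}_k(\theta)=\theta(f_{N_k}(x_k)-m_k(p_k))+(1-\theta)(h(N_k)-h(\widetilde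 N_{k+1}))$ and $\mathrm{Ared}_k(\theta)=\theta(f_{N_k}(x_k)-f_{N_{k+1}}(x_k+p_k))+(1-\theta)(h(N_k)-h(N_{k+1}))$. Iteration $k$ ends when the step is accepted in Step 5 (or the algorithm stops in Step 2); iterations are counted by $k$ (inner repetitions of Steps 2--5 are not counted), including the final iteration at which the stopping test holds. Constants. $\underline\theta>0$ is a constant independent of $k$ with $\theta_{k+1}\ge\underline\theta$ for all $k$ (such a constant exists under the assumptions); $\kappa_T=L+\kappa_B/2$; $\beta=1+\kappa_B$. The hypothesis $\underline h^{-1}=\mathcal O(\varepsilon_g^{-2})$ means $\underline h^{-1}\le C\varepsilon_g^{-2}$ for a constant $C$ independent of $\varepsilon_g$; likewise $\nu_4$ does not depend on $\varepsilon_g$. *)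

(* Defs.v *)
From HB Require Import structures.
From mathcomp Require Import all_boot all_order all_algebra.
From mathcomp Require Import all_classical all_reals all_analysis.
Import Order.TTheory GRing.Theory Num.Theory.
Import numFieldNormedType.Exports.

Set Implicit Arguments.
Unset Strict Implicit.
Unset Printing Implicit Defensive.

Local Open Scope classical_set_scope.
Local Open Scope ring_scope.

(* The library norm on matrices is the sup norm, hence the Euclidean norm and
   the induced operator norm below.  Points of R^n are row vectors. *)

Definition dotr (R : realType) (n : nat) (u v : 'rV[R]_n) : R :=
  (u *m v^T) 0 0.

Definition enorm (R : realType) (n : nat) (v : 'rV[R]_n) : R :=
  Num.sqrt (dotr v v).

(* [v *m B^T] is the row form of the column B v. *)
Definition opnorm (R : realType) (n : nat) (B : 'M[R]_n) : R :=
  sup [set enorm (v *m B^T) | v in [set v : 'rV[R]_n | enorm v <= 1]].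

Definition grad (R : realType) (n : nat) (f : 'rV[R]_n -> R) (x : 'rV[R]_n)
    : 'rV[R]_n :=
  \row_j 'D_(delta_mx 0 j) f x.

Definition C1 (R : realType) (n : nat) (f : 'rV[R]_n -> R) : Prop :=
  (forall x, differentiable f x) /\ continuous (grad f).

Definition segment (R : realType) (n : nat) (x y : 'rV[R]_n) : set 'rV[R]_n :=
  [set x + t *: (y - x) | t in `[0, 1]].

Definition lipschitz_grad_on (R : realType) (n : nat) (L : R)
    (A : set 'rV[R]_n) (f : 'rV[R]_n -> R) : Prop :=
  forall y z, A y -> A z -> enorm (grad f y - grad f z) <= L * enorm (y - z).

(* f_M, for the sample I = I_M and M = #|I| *)
Definition favg (R : realType) (n N : nat) (phi : 'I_N -> 'rV[R]_n -> R)
    (I : {set 'I_N}) (x : 'rV[R]_n) : R :=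
  #|I|%:R^-1 * \sum_(i in I) phi i x.

(* The accuracy level eps_g is kept out of the data record because the
   complexity constants must be uniform in it. *)
Record iretr_data (R : realType) (n : nat) := IretrData {
  x_init : 'rV[R]_n;
  N_init : nat;
  theta_init : R;
  Delta_init : R;
  zeta1 : R;
  zeta2 : R;
  gamma : R;
  r : R;
  eta : R;
  tau : R;
  mu : R
}.

Definition valid_data (R : realType) (n N : nat) (D : iretr_data R n) : Prop :=
  [/\ (0 < N_init D <= N)%N,
      0 < theta_init D < 1,
      0 < Delta_init D,
      0 < zeta1 D < 1 &
      1 < zeta2 D] /\
  [/\ 0 < gamma D <= 1,
      0 < r D < 1,
      0 < eta D < 1,
      0 < tau D < 1 &
      0 <= mu D < 1].

(* The choices made in one pass through Step 2. *)
Record trial (R : realType) (n N : nat) := Trial {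
  smp : {set 'I_N};          (* I_{N_{k+1}}, so N_{k+1} = #|smp| *)
  hess : 'M[R]_n;            (* B_{k+1} *)
  step : 'rV[R]_n;           (* p_k *)
  cauchy_step : 'rV[R]_n     (* p_k^C *)
}.

(* [Delta_ k T] is Delta_k^{(T)} and [trial_ k T] is the pass through Step 2
   made with that radius.  Only the entries at the pairs (k, T) satisfying
   [reached] below are meaningful: the others are unconstrained. *)
Record trace (R : realType) (n N : nat) := Trace {
  x_ : nat -> 'rV[R]_n;
  I_ : nat -> {set 'I_N};    (* I_{N_k}, so N_k = #|I_ k| *)
  theta_ : nat -> R;
  Ntilde_ : nat -> nat;      (* [Ntilde_ k] is \widetilde N_{k+1} *)
  Delta_ : nat -> nat -> R;
  trial_ : nat -> nat -> trial R n N
}.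

Section Algorithm.
Context (R : realType) (n N : nat) (phi : 'I_N -> 'rV[R]_n -> R).
Context (h : nat -> R) (D : iretr_data R n) (eps_g : R) (e : trace R n N).
Implicit Types (k T : nat) (p : 'rV[R]_n) (theta : R).

Definition Nk k : nat := #|I_ e k|.
Definition Nnext k T : nat := #|smp (trial_ e k T)|.

Definition model_grad k T : 'rV[R]_n :=
  grad (favg phi (smp (trial_ e k T))) (x_ e k).

Definition model k T p : R :=
  favg phi (smp (trial_ e k T)) (x_ e k) + dotr (model_grad k T) p
  + 2^-1 * (p *m hess (trial_ e k T) *m p^T) 0 0.

Definition cauchy_set k T : set 'rV[R]_n :=
  [set p | enorm p <= Delta_ e k T /\
           exists2 t : R, 0 < t & p = - (t *: model_grad k T)].

Definition is_cauchy_step k T p : Prop :=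
  cauchy_set k T p /\ forall q, cauchy_set k T q -> model k T p <= model k T q.

Definition model_decrease k T : R :=
  model k T 0 - model k T (step (trial_ e k T)).

Definition cauchy_decrease k T : R :=
  model k T 0 - model k T (cauchy_step (trial_ e k T)).

Definition Pred k T theta : R :=
  theta * (favg phi (I_ e k) (x_ e k) - model k T (step (trial_ e k T)))
  + (1 - theta) * (h (Nk k) - h (Ntilde_ e k)).

Definition Ared k T theta : R :=
  theta * (favg phi (I_ e k) (x_ e k)
           - favg phi (smp (trial_ e k T)) (x_ e k + step (trial_ e k T)))
  + (1 - theta) * (h (Nk k) - h (Nnext k T)).

Definition step1 k : Prop :=
  if (Nk k < N)%N
  then (Nk k < Ntilde_ e k <= N)%N /\ h (Ntilde_ e k) <= r D * h (Nk k)
  else Ntilde_ e k = N.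

Definition step2_sample k T : Prop :=
  (1 <= Nnext k T <= Ntilde_ e k)%N /\
  h (Nnext k T) - h (Ntilde_ e k) <= mu D * Delta_ e k T `^ (1 + gamma D).

Definition stops k T : Prop :=
  Nk k = N /\ enorm (model_grad k T) <= eps_g.

Definition step2_model k T : Prop :=
  [/\ (hess (trial_ e k T))^T = hess (trial_ e k T),
      is_cauchy_step k T (cauchy_step (trial_ e k T)),
      enorm (step (trial_ e k T)) <= Delta_ e k T &
      tau D * cauchy_decrease k T <= model_decrease k T].

Definition step3_rejects k T : Prop :=
  [/\ Nk k = N, (Nnext k T < N)%N &
      favg phi [set: 'I_N] (x_ e k) - model k T (step (trial_ e k T))
      < tau D * cauchy_decrease k T].

Definition theta_next k T : R :=
  let H := h (Nk k) - h (Ntilde_ e k) in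
  if eta D * H <= Pred k T (theta_ e k) then theta_ e k
  else (1 - eta D) * H /
       (model k T (step (trial_ e k T)) - favg phi (I_ e k) (x_ e k) + H).

Definition step5_test k T : Prop :=
  eta D * Pred k T (theta_next k T) <= Ared k T (theta_next k T).

Definition accepts k T : Prop :=
  [/\ ~ stops k T, ~ step3_rejects k T & step5_test k T].

Definition repeats k T : Prop :=
  ~ stops k T /\ (step3_rejects k T \/ ~ step5_test k T).

(* [reached k T]: the execution gets to Step 2 of iteration k with T_k = T. *)
Inductive reached : nat -> nat -> Prop :=
| reached0 : reached 0 0
| reached_repeat k T : reached k T -> repeats k T -> reached k T.+1
| reached_accept k T : reached k T -> accepts k T -> reached k.+1 0.

(* p_k is generated for the current trial, i.e. the stopping test failed. *)
Definition tried k T : Prop := reached k T /\ ~ stops k T.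

(* [e] is a complete execution of the algorithm: exactly one of [stops],
   [repeats], [accepts] holds at each reached pair, so that [e] either goes on
   for ever (in k or in T) or ends at a reached pair satisfying [stops]. *)
Record iretr_run : Prop := IretrRun {
  run_x0 : x_ e 0 = x_init D;
  run_N0 : Nk 0 = N_init D;
  run_theta0 : theta_ e 0 = theta_init D;
  run_Delta0 : Delta_ e 0 0 = Delta_init D;
  run_step1 : forall k, reached k 0 -> step1 k;
  run_sample : forall k T, reached k T -> step2_sample k T;
  run_model : forall k T, tried k T -> step2_model k T;
  run_repeat : forall k T, reached k T -> repeats k T ->
    Delta_ e k T.+1 = zeta1 D * Delta_ e k T;
  run_accept : forall k T, reached k T -> accepts k T ->
    [/\ x_ e k.+1 = x_ e k + step (trial_ e k T),
        I_ e k.+1 = smp (trial_ e k T),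
        theta_ e k.+1 = theta_next k T &
        Delta_ e k T <= Delta_ e k.+1 0 <= zeta2 D * Delta_ e k T]
}.

Definition iterates_in (Omega : set 'rV[R]_n) : Prop :=
  forall k, reached k 0 -> Omega (x_ e k).

Definition gradients_lipschitz (L : R) : Prop :=
  forall k T i, tried k T ->
    lipschitz_grad_on L
      (segment (x_ e k) (x_ e k + step (trial_ e k T))) (phi i).

Definition hessians_bounded (kappaB : R) : Prop :=
  forall k T, tried k T -> opnorm (hess (trial_ e k T)) <= kappaB.

Definition theta_bounded_below (theta_low : R) : Prop :=
  forall k, reached k.+1 0 -> theta_low <= theta_ e k.+1.

(* The stopping test holds during iteration k <= m - 1; since k starts at 0,
   this is the (k + 1)-st iteration. *)
Definition terminates_within (m : int) : Prop :=
  exists k T, [/\ reached k T, stops k T & k.+1%:Z <= m].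

End Algorithm.

(* Stated on positive integers only: h(0) plays no role. *)
Definition strictly_decreasing (R : realType) (h : nat -> R) : Prop :=
  forall i j, (0 < i < j)%N -> h j < h i.

Definition kappaT (R : realType) (L kappaB : R) : R := L + kappaB / 2.

Definition beta (R : realType) (kappaB : R) : R := 1 + kappaB.

Definition Gamma (R : realType) (n : nat) (D : iretr_data R n)
    (L kappaB theta_low : R) : R :=
  Num.min (1 / beta kappaB)
    (tau D * theta_low * (1 - eta D) / (2 * (kappaT L kappaB + mu D))).

(* Main.v *)
(* Each accepted step decreases the merit function theta f + (1 - theta) h by at
   least eta Pred, up to terms that telescope because theta_k is nonincreasing in
   (0, 1].  As the iterates stay in a compact set, the total decrease is bounded,
   so it suffices that Pred >= c eps_g^2 at every acceptance.  If N_k < N, then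
   Pred is at least a multiple of h(N - 1), hence of eps_g^2.  If N_k = N, the
   Cauchy decrease gives Pred >= c eps_g min(Delta, eps_g / beta), and
   Delta >= c eps_g because a trial with radius at most a fixed multiple of
   eps_g is always accepted: the error Pred - Ared is only
   (kappa_T + mu) Delta^2.  The same fact makes the inner repetitions finite. *)
Require Import Defs.
From mathcomp Require Import all_boot all_order all_algebra.
From mathcomp Require Import all_classical all_reals all_analysis.
From mathcomp Require Import ring lra.
Import Order.TTheory GRing.Theory Num.Theory.
Import numFieldNormedType.Exports.
Local Open Scope classical_set_scope.
Local Open Scope ring_scope.

Set Implicit Arguments.
Unset Strict Implicit.

(** * Euclidean norm, induced operator norm and quadratic forms *)

Section Euclidean.
Context (R : realType) (n : nat).
Implicit Types (u v w p : 'rV[R]_n) (B : 'M[R]_n).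

Lemma dotrE u v : dotr u v = \sum_j u 0 j * v 0 j.
Proof. by rewrite /dotr mxE; apply: eq_bigr => j _; rewrite mxE. Qed.

Lemma dotrC u v : dotr u v = dotr v u.
Proof. by rewrite !dotrE; apply: eq_bigr => j _; rewrite mulrC. Qed.

Lemma dotrDl u v w : dotr (u + v) w = dotr u w + dotr v w.
Proof. by rewrite /dotr mulmxDl mxE. Qed.

Lemma dotrZl (c : R) u v : dotr (c *: u) v = c * dotr u v.
Proof. by rewrite /dotr -scalemxAl mxE. Qed.

Lemma dotrZr (c : R) u v : dotr u (c *: v) = c * dotr u v.
Proof. by rewrite dotrC dotrZl dotrC. Qed.

Lemma dotrBl u v w : dotr (u - v) w = dotr u w - dotr v w.
Proof. by rewrite -scaleN1r dotrDl dotrZl mulN1r. Qed.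

Lemma dotrr_ge0 u : 0 <= dotr u u.
Proof. by rewrite dotrE; apply: sumr_ge0 => j _; rewrite -expr2 sqr_ge0. Qed.

Lemma enorm_ge0 u : 0 <= enorm u.
Proof. exact: sqrtr_ge0. Qed.

Lemma sqr_enorm u : enorm u ^+ 2 = dotr u u.
Proof. by rewrite sqr_sqrtr // dotrr_ge0. Qed.

Lemma enormZ (c : R) u : enorm (c *: u) = `|c| * enorm u.
Proof.
by rewrite /enorm dotrZl dotrZr mulrA -expr2 sqrtrM ?sqr_ge0 // sqrtr_sqr.
Qed.

Lemma enorm0_eq0 u : enorm u = 0 -> u = 0.
Proof.
move=> u0; have /eqP := sqr_enorm u; rewrite u0 expr0n /= eq_sym dotrE.
rewrite psumr_eq0 => [/allP h|j _]; last by rewrite -expr2 sqr_ge0.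
apply/rowP => j; rewrite mxE; apply/eqP.
by have := h j (mem_index_enum j); rewrite -expr2 sqrf_eq0.
Qed.

Lemma dotr0l v : dotr 0 v = 0.
Proof. by rewrite -(scale0r 0) dotrZl mul0r. Qed.

Lemma cauchy_schwarz u v : `|dotr u v| <= enorm u * enorm v.
Proof.
have [u0|u_neq0] := eqVneq (enorm u) 0.
  by rewrite (enorm0_eq0 u0) dotr0l normr0 mulr_ge0 ?enorm_ge0.
rewrite -ler_sqr ?nnegrE ?mulr_ge0 ?enorm_ge0 // real_normK ?num_real //.
have u_gt0 : 0 < dotr u u by rewrite -sqr_enorm exprn_gt0 // lt0r u_neq0 enorm_ge0.
rewrite exprMn !sqr_enorm -subr_ge0 -(pmulr_rge0 _ u_gt0).
(* The squared norm of this vector is |u|^2 (|u|^2 |v|^2 - <u,v>^2). *)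
have := dotrr_ge0 (dotr u u *: v - dotr u v *: u).
rewrite dotrBl !dotrZl (dotrC _ (_ - _)) (dotrC _ (_ - _)) !dotrBl !dotrZl.
rewrite (dotrC v u); set a := dotr u u; set b := dotr v v; set c := dotr u v.
by move=> /le_trans; apply; rewrite le_eqVlt; apply/orP; left; apply/eqP; ring.
Qed.

(** Cauchy-Schwarz on each row of [B]. This Frobenius bound serves to show that the set whose
    supremum is [opnorm B] is bounded above. *)
Lemma enorm_mulmxT_le B u :
  enorm (u *m B^T) <= Num.sqrt (\sum_i enorm (row i B) ^+ 2) * enorm u.
Proof.
rewrite -[leRHS]ger0_norm ?mulr_ge0 ?sqrtr_ge0 ?enorm_ge0 // -sqrtr_sqr.
rewrite ler_sqrt ?sqr_ge0 // exprMn sqr_sqrtr; last first.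
  by apply: sumr_ge0 => i _; rewrite sqr_ge0.
rewrite dotrE mulr_suml; apply: ler_sum => i _.
rewrite -expr2 -exprMn.
have -> : (u *m B^T) 0 i = dotr (row i B) u.
  by rewrite dotrE mxE; apply: eq_bigr => j _; rewrite !mxE mulrC.
rewrite -[leLHS]real_normK ?num_real // ler_sqr ?nnegrE ?mulr_ge0 ?enorm_ge0 //.
exact: cauchy_schwarz.
Qed.

Lemma enorm_mulmxT_opnorm B u : enorm (u *m B^T) <= opnorm B * enorm u.
Proof.
have [u0|u_neq0] := eqVneq (enorm u) 0.
  by have := enorm_mulmxT_le B u; rewrite u0 !mulr0.
have u_gt0 : 0 < enorm u by rewrite lt0r u_neq0 enorm_ge0.
rewrite -ler_pdivrMr //.
apply: ub_le_sup; last first.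
  exists ((enorm u)^-1 *: u).
    by rewrite /= enormZ ger0_norm ?invr_ge0 ?enorm_ge0 // mulVf.
  by rewrite -scalemxAl enormZ ger0_norm ?invr_ge0 ?enorm_ge0 // mulrC.
exists (Num.sqrt (\sum_i enorm (row i B) ^+ 2)) => _ [v /= v1 <-].
apply: le_trans (enorm_mulmxT_le B v) _.
by rewrite -[leRHS]mulr1 ler_wpM2l // sqrtr_ge0.
Qed.

Lemma quadratic_form_le B u :
  `|(u *m B *m u^T) 0 0| <= opnorm B * enorm u ^+ 2.
Proof.
have -> : (u *m B *m u^T) 0 0 = dotr u (u *m B^T).
  by rewrite /dotr trmx_mul trmxK mulmxA.
apply: le_trans (cauchy_schwarz _ _) _.
by rewrite expr2 mulrCA ler_wpM2l ?enorm_ge0 // enorm_mulmxT_opnorm.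
Qed.

End Euclidean.

(** * Gradients, first-order error and bounds on compact sets *)

Section Differential.
Context (R : realType) (n : nat).
Implicit Types (f : 'rV[R]_n -> R) (x y v p : 'rV[R]_n).

Lemma derive_dotr_grad f x v :
  differentiable f x -> 'D_v f x = dotr (grad f x) v.
Proof.
move=> df; rewrite deriveE // {1}[v]row_sum_delta linear_sum dotrE.
by apply: eq_bigr => j _; rewrite linearZ mxE deriveE // mulrC.
Qed.

(** The difference quotient at [t] is that of [f] at [x + t *: p] in the direction [p]. *)
Lemma is_derive_line f x p (t : R) : (forall y, differentiable f y) ->
  is_derive t 1 (fun s : R => f (x + s *: p)) (dotr (grad f (x + t *: p)) p).
Proof.
move=> df; rewrite -derive_dotr_grad //.
have eq_quot : (fun s : R => s^-1 *:
      (((fun s : R => f (x + s *: p)) \o shift t) (s *: 1) - f (x + t *: p))) =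
    (fun s : R => s^-1 *: ((f \o shift (x + t *: p)) (s *: p) - f (x + t *: p))).
  apply/funext => s /=; congr (_ *: (f _ - _)).
  by rewrite scalerDl addrCA /GRing.scale /= mulr1.
apply: DeriveDef; rewrite /derivable /derive eq_quot //.
exact: diff_derivable.
Qed.

(** The mean value theorem turns the increment into a derivative at an interior point of the
    segment; comparing gradients there and at [x] gives the constant [L], the one that enters
    [kappaT]. *)
Lemma first_order_error f x p (L : R) : (forall y, differentiable f y) ->
  0 <= L -> lipschitz_grad_on L (segment x (x + p)) f ->
  `|f (x + p) - f x - dotr (grad f x) p| <= L * enorm p ^+ 2.
Proof.
move=> df L_ge0 lip.
pose g (s : R) := f (x + s *: p).
have dg (s : R) : is_derive s 1 g (dotr (grad f (x + s *: p)) p).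
  exact: is_derive_line.
have g_cont : {within `[0, 1], continuous g}.
  by apply: derivable_within_continuous => s _; apply: ex_derive.
have [c c01] := MVT ltr01 (fun s _ => dg s) g_cont.
rewrite /g scale1r scale0r addr0 subr0 mulr1 => ->.
rewrite -dotrBl; apply: le_trans (cauchy_schwarz _ _) _.
rewrite expr2 mulrA ler_wpM2r ?enorm_ge0 //.
move: c01; rewrite in_itv /= => /andP[c_gt0 c_lt1].
apply: (le_trans (lip _ _ _ _)).
- by exists c; [rewrite /= in_itv /= !ltW | rewrite /= (addrC x p) addrK].
- by exists 0; [rewrite /= in_itv /= lexx ler01 | rewrite /= scale0r addr0].
rewrite addrAC subrr add0r enormZ ler_wpM2l // gtr0_norm //.
by rewrite ler_piMl ?enorm_ge0 // ltW.
Qed.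

Lemma continuous_bounded_on_compact f (A : set 'rV[R]_n) : continuous f ->
  compact A -> exists2 M : R, 0 <= M & forall x, A x -> `|f x| <= M.
Proof.
move=> cf cA.
have cfA : compact (f @` A) by apply: continuous_compact => //; exact: continuous_subspaceT.
have [M [_ bM]] := compact_bounded cfA.
exists (`|M| + 1); first by rewrite addr_ge0.
move=> x Ax; apply: (bM (`|M| + 1)); last by exists x.
by rewrite (le_lt_trans (ler_norm M)) // ltrDl.
Qed.

End Differential.

(** * Averages over samples *)

Section Averages.
Context (R : realType) (n N : nat) (phi : 'I_N -> 'rV[R]_n -> R).
Implicit Types (I : {set 'I_N}) (x p : 'rV[R]_n).

Lemma mean_le I (a : 'I_N -> R) (M : R) : 0 <= M ->
  (forall i, `|a i| <= M) -> `|#|I|%:R^-1 * \sum_(i in I) a i| <= M.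
Proof.
move=> M_ge0 aM.
have [->|I_neq0] := eqVneq I finset.set0.
  by rewrite big_set0 mulr0 normr0.
have I_gt0 : 0 < #|I|%:R :> R by rewrite ltr0n card_gt0.
rewrite normrM ger0_norm ?invr_ge0 ?ler0n // mulrC ler_pdivrMr //.
apply: le_trans (ler_norm_sum _ _ _) _.
apply: le_trans (ler_sum _ (fun i _ => aM i)) _.
by rewrite sumr_const mulr_natr.
Qed.

Lemma grad_favg I x : (forall i y, differentiable (phi i) y) ->
  grad (favg phi I) x = #|I|%:R^-1 *: \sum_(i in I) grad (phi i) x.
Proof.
move=> dphi; apply/rowP => j; rewrite !mxE summxE.
have -> : favg phi I = #|I|%:R^-1 \*: \sum_(i in I) phi i.
  by apply/funext => y; rewrite /favg /= fct_sumE.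
set v := delta_mx 0 j.
have dsum : is_derive x v (\sum_(i in I) phi i) (\sum_(i in I) 'D_v (phi i) x).
  elim/big_rec2 : _ => [|i F dF _ dFx]; first exact: is_derive_cst.
  apply: is_deriveD; apply: DeriveDef => //; exact: diff_derivable.
rewrite deriveZ; last exact: ex_derive.
by rewrite derive_val; congr (_ * _); apply: eq_bigr => i _; rewrite mxE.
Qed.

Lemma favg_first_order_error I x p (L : R) :
  (forall i y, differentiable (phi i) y) -> 0 <= L ->
  (forall i, lipschitz_grad_on L (segment x (x + p)) (phi i)) ->
  `|favg phi I (x + p) - favg phi I x - dotr (grad (favg phi I) x) p|
    <= L * enorm p ^+ 2.
Proof.
move=> dphi L_ge0 lip; rewrite grad_favg // dotrZl /favg -!mulrBr.
have -> : dotr (\sum_(i in I) grad (phi i) x) p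
    = \sum_(i in I) dotr (grad (phi i) x) p.
  by rewrite /dotr mulmx_suml summxE.
rewrite -!sumrB; apply: mean_le => [|i]; first by rewrite mulr_ge0 ?sqr_ge0.
exact: first_order_error.
Qed.

Lemma favg_bounded_on_compact (A : set 'rV[R]_n) :
  (forall i y, differentiable (phi i) y) -> compact A ->
  exists2 M : R, 0 <= M & forall I x, A x -> `|favg phi I x| <= M.
Proof.
move=> dphi cA.
have phi_bound i : exists2 M : R, 0 <= M & forall x, A x -> `|phi i x| <= M.
  apply: continuous_bounded_on_compact => // x.
  exact: differentiable_continuous.
have [M M_ge0 phiM] := fin_all_exists2 phi_bound.
(* The sum of the finitely many bounds dominates each of them, hence every average, uniformly in the
   sample. *)
exists (\sum_i M i); first exact: sumr_ge0.
move=> I x Ax; apply: mean_le => [|i]; first exact: sumr_ge0.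
by rewrite (le_trans (phiM i x Ax)) // (bigD1 i) //= lerDl sumr_ge0.
Qed.

End Averages.

(** * The infeasibility measure *)

Section Decreasing.
Context (R : realType) (N : nat) (h : nat -> R).
Hypotheses (h_decr : strictly_decreasing h) (h_N : h N = 0).

Lemma decreasing_le i j : (0 < i <= j)%N -> h j <= h i.
Proof.
case/andP=> i_gt0; rewrite leq_eqVlt => /predU1P[->//|ij].
by rewrite ltW // h_decr // i_gt0.
Qed.

Lemma infeasibility_ge0 i : (0 < i <= N)%N -> 0 <= h i.
Proof. by move=> iN; rewrite -h_N; exact: decreasing_le. Qed.

Lemma infeasibility_ge_pred i : (0 < i < N)%N -> h N.-1 <= h i.
Proof.
case/andP=> i_gt0 iN; apply: decreasing_le.
by rewrite i_gt0 -ltnS prednK // (leq_ltn_trans _ iN).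
Qed.

End Decreasing.

(** * Invariants of one execution of the algorithm *)

Section Run.
Context (R : realType) (n N : nat) (phi : 'I_N -> 'rV[R]_n -> R).
Context (h : nat -> R) (D : iretr_data R n) (eps_g : R) (e : trace R n N).
Context (L kappaB theta_low : R).
Hypothesis dphi : forall i y, differentiable (phi i) y.
Hypothesis h_decr : strictly_decreasing h.
Hypothesis h_N : h N = 0.
Hypothesis N_gt1 : (1 < N)%N.
Hypothesis hD : valid_data N D.
Hypothesis hgamma : gamma D = 1.
Hypothesis L_ge0 : 0 <= L.
Hypothesis kappaB_gt0 : 0 < kappaB.
Hypothesis theta_low_gt0 : 0 < theta_low.
Hypothesis eps_gt0 : 0 < eps_g.
Hypothesis run : iretr_run phi h D eps_g e.
Hypothesis lip : gradients_lipschitz phi h D eps_g e L.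
Hypothesis hess_bound : hessians_bounded phi h D eps_g e kappaB.
Hypothesis theta_bound : theta_bounded_below phi h D eps_g e theta_low.

Local Notation reached := (reached phi h D eps_g e).
Local Notation tried := (tried phi h D eps_g e).
Local Notation stops := (stops phi eps_g e).
Local Notation repeats := (repeats phi h D eps_g e).
Local Notation accepts := (accepts phi h D eps_g e).
Local Notation rejects := (step3_rejects phi D e).
Local Notation theta_next := (theta_next phi h D e).
Local Notation Pred := (Pred phi h e).
Local Notation Ared := (Ared phi h e).
Local Notation model := (model phi e).
Local Notation model_grad := (model_grad phi e).
Local Notation Nk := (Nk e).
Local Notation Nnext := (Nnext e).
Local Notation h_min := (h N.-1).
Local Notation drop k := (h (Nk k) - h (Ntilde_ e k)).
Local Notation kappa := (kappaT L kappaB + mu D).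
Local Notation beta := (beta kappaB).

(* [theta_bound] says nothing about theta_0: theta_1 is only constrained once
   iteration 0 has accepted a step. *)
Definition theta_min : R := Num.min theta_low (theta_init D).

Implicit Types k T : nat.

Lemma beta_gt0 : 0 < beta.
Proof. by rewrite /Defs.beta addr_gt0. Qed.

Lemma theta_min_gt0 : 0 < theta_min.
Proof. by rewrite lt_min theta_low_gt0 /=; case: hD => -[_ /andP[]]. Qed.

Lemma kappa_gt0 : 0 < kappa.
Proof.
have [_ [_ _ _ _ /andP[mu_ge0 _]]] := hD.
by rewrite /kappaT; move: (kappaB_gt0) (L_ge0); lra.
Qed.

Lemma h_min_gt0 : 0 < h_min.
Proof.
by rewrite -h_N h_decr // prednK ?leqnn ?andbT -?subn1 ?subn_gt0 // ltnW.
Qed.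

Lemma reached_start k T : reached k T -> reached k 0.
Proof.
elim=> {k T} [|k T _ h0 _|k T hk _ acc] //; first exact: reached0.
exact: reached_accept hk acc.
Qed.

Lemma reachedS k : reached k.+1 0 -> exists2 T, reached k T & accepts k T.
Proof.
by move=> hk; inversion hk as [| |k' T hT acc]; subst; exists T.
Qed.

Lemma Nk_bounds k T : reached k T -> (0 < Nk k <= N)%N.
Proof.
move=> hk; apply/andP; split; last by rewrite -[leqRHS]card_ord max_card.
case: k hk => [|k] /reached_start hk.
  by rewrite (run_N0 run); case: hD => -[/andP[]].
have [T' hT acc] := reachedS hk.
have [_ IE _ _] := run_accept run hT acc.
rewrite /Defs.Nk IE.
by have [/andP[]] := run_sample run hT.
Qed.

Lemma Delta_gt0 k T : reached k T -> 0 < Delta_ e k T.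
Proof.
have [[_ _ Delta0_gt0 /andP[zeta1_gt0 _] _] _] := hD.
elim=> {k T} [|k T hk IH rep|k T hk IH acc].
- by rewrite (run_Delta0 run).
- by rewrite (run_repeat run hk rep) mulr_gt0.
- by have [_ _ _ /andP[le_D _]] := run_accept run hk acc; exact: lt_le_trans le_D.
Qed.

Lemma drop_full k T : reached k T -> Nk k = N -> drop k = 0.
Proof.
move=> /reached_start /(run_step1 run); rewrite /step1 => s1 NkN.
by move: s1; rewrite NkN ltnn => ->; rewrite subrr.
Qed.

(** Step 1 makes the drop at least (1 - r) h(N_k), and h(N_k) >= h(N - 1) for a proper sample. *)
Lemma drop_partial k T : reached k T -> (Nk k < N)%N ->
  (1 - r D) * h_min <= drop k.
Proof.
move=> hk; have := run_step1 run (reached_start hk).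
rewrite /step1 => s1 NkN; move: s1; rewrite NkN => -[_ hr].
have [_ [_ /andP[_ r_lt1] _ _ _]] := hD.
have /andP[Nk_gt0 _] := Nk_bounds hk.
have hNk : h_min <= h (Nk k) by apply: infeasibility_ge_pred; rewrite ?Nk_gt0.
move: hr hNk r_lt1; nra.
Qed.

Lemma sample_infeasibility k T : reached k T ->
  h (Nnext k T) - h (Ntilde_ e k) <= mu D * Delta_ e k T ^+ 2.
Proof.
move=> hk; have [_] := run_sample run hk.
by rewrite hgamma -[1 + 1]/(2%:R) powR_mulrn // ltW // (Delta_gt0 hk).
Qed.

(** * Decrease of the quadratic model *)

Lemma model0 k T : model k T 0 = favg phi (smp (trial_ e k T)) (x_ e k).
Proof.
by rewrite /Defs.model mul0mx mul0mx mxE mulr0 addr0 dotrC dotr0l addr0.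
Qed.

Lemma model_gradient_step k T (t : R) :
  model k T 0 - model k T (- (t *: model_grad k T)) =
  t * enorm (model_grad k T) ^+ 2
  - 2^-1 * (t ^+ 2 * (model_grad k T *m hess (trial_ e k T)
                      *m (model_grad k T)^T) 0 0).
Proof.
rewrite model0 /Defs.model -scaleNr dotrZr linearZ /= -!scalemxAl -scalemxAr.
by rewrite !mxE -sqr_enorm /=; ring.
Qed.

(** The Cauchy step does at least as well as the gradient step with parameter t = min(Delta / g, 1 /
    beta), where g is the gradient norm. Since t kappa_B <= 1, the quadratic term cancels at most
    half of the linear gain t g^2, and t g is the minimum in the bound. *)
Lemma cauchy_decrease_ge k T : tried k T ->
  2^-1 * enorm (model_grad k T)
    * Num.min (Delta_ e k T) (enorm (model_grad k T) / beta)
  <= cauchy_decrease phi e k T.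
Proof.
move=> tr; have Delta_pos := Delta_gt0 tr.1.
have [_ [[_ [t0 t0_gt0 pC]] pC_min] _ _] := run_model run tr.
rewrite /cauchy_decrease.
(* For a zero gradient the Cauchy step is 0 and both sides vanish; the choice of [t] below divides
   by g. *)
have [g0|g_neq0] := eqVneq (enorm (model_grad k T)) 0.
  by rewrite g0 mulr0 mul0r pC (enorm0_eq0 g0) scaler0 oppr0 subrr.
set g := enorm _ in g_neq0 *.
have g_gt0 : 0 < g by rewrite lt0r g_neq0 enorm_ge0.
pose t := Num.min (Delta_ e k T / g) beta^-1.
have t_gt0 : 0 < t by rewrite lt_min divr_gt0 //= invr_gt0 beta_gt0.
have t_beta : t * beta <= 1.
  by rewrite -ler_pdivlMr ?beta_gt0 // mul1r ge_min lexx orbT.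
have tg : t * g = Num.min (Delta_ e k T) (g / beta).
  by rewrite /t minr_pMl ?ltW // divfK // mulrC.
have t_in : cauchy_set phi e k T (- (t *: model_grad k T)).
  split; last by exists t.
  by rewrite -scaleNr enormZ normrN gtr0_norm // -/g tg ge_min lexx.
rewrite -tg; apply: le_trans (lerB (lexx _) (pC_min _ t_in)).
rewrite model_gradient_step -/g.
have := le_trans (ler_norm _) (quadratic_form_le (hess (trial_ e k T)) (model_grad k T)).
rewrite -/g; set q := (_ *m _ *m _) 0 0 => q_le.
have {q_le} q_le : q <= kappaB * g ^+ 2.
  by apply: le_trans q_le _; rewrite ler_wpM2r ?sqr_ge0 // hess_bound.
have ht : t * kappaB <= 1 by move: t_beta; rewrite /Defs.beta; lra.
have h1 : t ^+ 2 * q <= t ^+ 2 * (kappaB * g ^+ 2) by rewrite ler_wpM2l ?sqr_ge0.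
have h2 : (t * g ^+ 2) * (t * kappaB) <= t * g ^+ 2.
  by rewrite ler_piMr // mulr_ge0 ?sqr_ge0 // ltW.
by move: h1 h2; lra.
Qed.

Lemma gradient_gt_eps k T : tried k T -> Nk k = N ->
  eps_g < enorm (model_grad k T).
Proof. by move=> [_ nst] NkN; rewrite ltNge; apply/negP => le; apply: nst. Qed.

(** If the trial sample is proper, passing Step 3 is exactly a decrease of [tau D] times the Cauchy
    decrease. Otherwise both samples are full, [model k T 0] is f_N(x_k), and Step 2 gives the same
    decrease. *)
Lemma full_sample_decrease k T : tried k T -> ~ rejects k T -> Nk k = N ->
  tau D * (2^-1 * eps_g * Num.min (Delta_ e k T) (eps_g / beta))
  <= favg phi (I_ e k) (x_ e k) - model k T (step (trial_ e k T)).
Proof.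
move=> tr nrej NkN.
have [_ [_ _ _ /andP[tau_gt0 _] _]] := hD.
have Delta_pos := Delta_gt0 tr.1.
have full (I : {set 'I_N}) : #|I| = N -> I = finset.setT.
  move=> cI; apply/eqP.
  by rewrite eqEcard finset.subsetT cardsT card_ord cI /=.
apply: (@le_trans _ _ (tau D * cauchy_decrease phi e k T)).
  rewrite ler_pM2l //; apply: le_trans (cauchy_decrease_ge tr).
  have g_gt := gradient_gt_eps tr NkN.
  apply: ler_pM.
  - by rewrite mulr_ge0 // ltW.
  - by rewrite le_min ltW //= divr_ge0 // ltW // beta_gt0.
  - by rewrite ler_pM2l // ltW.
  - by rewrite le_min2 // ler_pM2r ?invr_gt0 ?beta_gt0 // ltW.
have [sN|] := ltnP (Nnext k T) N.
  by rewrite (full _ NkN) leNgt; apply/negP => lt; apply: nrej.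
move=> sN; have {sN} sN : Nnext k T = N.
  by apply/eqP; rewrite eqn_leq sN andbT -[leqRHS]card_ord max_card.
have [_ _ _] := run_model run tr.
by rewrite /model_decrease model0 (full _ NkN) (full _ sN).
Qed.

(** * Predicted reduction and the weights theta *)

Lemma Pred_theta_full k T (theta : R) : reached k T -> Nk k = N ->
  Pred k T theta =
  theta * (favg phi (I_ e k) (x_ e k) - model k T (step (trial_ e k T))).
Proof. by move=> hk NkN; rewrite /Defs.Pred (drop_full hk NkN) mulr0 addr0. Qed.

Lemma theta_min_le k T : reached k T -> theta_min <= theta_ e k.
Proof.
case: k => [|k] /reached_start hk; first by rewrite (run_theta0 run) ge_min lexx orbT.
by rewrite ge_min theta_bound.
Qed.

Lemma theta_gt0 k T : reached k T -> 0 < theta_ e k.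
Proof. by move/theta_min_le; exact: lt_le_trans theta_min_gt0. Qed.

Lemma full_sample_decrease_ge0 k T : tried k T -> ~ rejects k T -> Nk k = N ->
  0 <= favg phi (I_ e k) (x_ e k) - model k T (step (trial_ e k T)).
Proof.
move=> tr nrej NkN; apply: le_trans (full_sample_decrease tr nrej NkN).
have [_ [_ _ _ /andP[tau_gt0 _] _]] := hD.
rewrite mulr_ge0 ?(ltW tau_gt0) // mulr_ge0 //; first by rewrite mulr_ge0 // ltW.
by rewrite le_min ltW ?(Delta_gt0 tr.1) //= divr_ge0 // ltW // beta_gt0.
Qed.

(** With zero drop the test of Step 4 reads Pred >= 0, which holds, so theta is kept. *)
Lemma theta_next_full k T : tried k T -> ~ rejects k T -> Nk k = N ->
  theta_next k T = theta_ e k.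
Proof.
move=> tr nrej NkN.
rewrite /Defs.theta_next /= (drop_full tr.1 NkN) mulr0.
rewrite Pred_theta_full //; last exact: tr.1.
by rewrite mulr_ge0 // ?full_sample_decrease_ge0 // ltW // (theta_gt0 tr.1).
Qed.

(** When Step 4 changes theta, the new value solves Pred(theta) = eta H, where H is the drop. *)
Lemma theta_next_spec k T : tried k T -> ~ rejects k T ->
  0 < theta_next k T <= theta_ e k
  /\ eta D * drop k <= Pred k T (theta_next k T).
Proof.
move=> tr nrej.
have [_ [_ _ /andP[eta_gt0 eta_lt1] _ _]] := hD.
have theta_pos := theta_gt0 tr.1.
have : (Nk k <= N)%N by have /andP[] := Nk_bounds tr.1.
rewrite leq_eqVlt => /predU1P[NkN|NkN].
  rewrite theta_next_full // theta_pos lexx; split=> //.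
  rewrite (drop_full tr.1 NkN) mulr0 Pred_theta_full //; last exact: tr.1.
  by rewrite mulr_ge0 // ?full_sample_decrease_ge0 // ltW.
have drop_gt0 : 0 < drop k.
  apply: lt_le_trans (drop_partial tr.1 NkN).
  have [_ [_ /andP[_ r_lt1] _ _ _]] := hD.
  by rewrite mulr_gt0 ?subr_gt0 // h_min_gt0.
rewrite /Defs.theta_next /=; case: ifPn => [pred_ok|].
  by rewrite theta_pos lexx.
rewrite -ltNge /Defs.Pred.
set H := drop k in drop_gt0 *.
set F := favg _ _ _; set m := model _ _ _ => pred_lt.
(* Since Pred(theta) = H - theta (m - F + H), the failed test says theta (m - F + H) > (1 - eta) H >
   0. *)
have d_gt0 : 0 < m - F + H by move: pred_lt; nra.
split.
  apply/andP; split; first by rewrite divr_gt0 // mulr_gt0 // subr_gt0.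
  by rewrite ler_pdivrMr //; move: pred_lt; lra.
set th := _ / _.
have thE : th * (m - F + H) = (1 - eta D) * H by rewrite /th divfK // gt_eqF.
by move: thE; lra.
Qed.

Lemma theta_le1 k T : reached k T -> theta_ e k <= 1.
Proof.
move/reached_start; elim: k => [_|k IH].
  by rewrite (run_theta0 run) ltW //; case: hD => -[_ /andP[]].
move=> /reachedS[T' hT [nst nrej acc]].
have [_ _ -> _] := run_accept run hT (And3 nst nrej acc).
have [/andP[_ le_th] _] := theta_next_spec (conj hT nst) nrej.
exact: le_trans le_th (IH (reached_start hT)).
Qed.

(** The difference is theta (f(x_k + p_k) - m(p_k)) + (1 - theta) (h(N_{k+1}) - h(Ntilde_{k+1})),
    with f the average over the trial sample. The first bracket is a first-order error plus half a
    Hessian term, at most kappa_T Delta^2; the second is at most mu Delta^2 by Step 2. *)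
Lemma Pred_sub_Ared k T (theta : R) : tried k T -> 0 <= theta <= 1 ->
  Pred k T theta - Ared k T theta <= kappa * Delta_ e k T ^+ 2.
Proof.
move=> tr /andP[th_ge0 th_le1].
have [_ [_ _ _ _ /andP[mu_ge0 _]]] := hD.
have [_ _ p_le _] := run_model run tr.
have Delta_pos := Delta_gt0 tr.1.
have infeas := sample_infeasibility tr.1.
have := favg_first_order_error (smp (trial_ e k T)) dphi L_ge0 (fun i => lip i tr).
move=> /(le_trans (ler_norm _)) err.
have := quadratic_form_le (hess (trial_ e k T)) (step (trial_ e k T)).
rewrite -normrN => /(le_trans (ler_norm _)) quad.
have hb := hess_bound tr.
have p2 : enorm (step (trial_ e k T)) ^+ 2 <= Delta_ e k T ^+ 2.
  by rewrite ler_sqr ?nnegrE ?enorm_ge0 // ltW.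
have p2_ge0 : 0 <= enorm (step (trial_ e k T)) ^+ 2 by rewrite sqr_ge0.
set F' := favg phi (smp (trial_ e k T)) (x_ e k + step (trial_ e k T)) in err.
have model_err : F' - model k T (step (trial_ e k T))
    <= kappaT L kappaB * Delta_ e k T ^+ 2.
  have hb2 := ler_wpM2r p2_ge0 hb.
  have kT_ge0 : 0 <= kappaT L kappaB.
    by rewrite /kappaT; move: (kappaB_gt0) (L_ge0); lra.
  have := ler_wpM2l kT_ge0 p2.
  apply: le_trans; rewrite /kappaT /Defs.model.
  by rewrite /Defs.model_grad; lra.
rewrite /Defs.Pred /Defs.Ared -/F'.
have kT_ge0 : 0 <= kappaT L kappaB * Delta_ e k T ^+ 2.
  by rewrite mulr_ge0 ?sqr_ge0 // /kappaT; move: (kappaB_gt0) (L_ge0); lra.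
have muD : 0 <= mu D * Delta_ e k T ^+ 2 by rewrite mulr_ge0 ?sqr_ge0.
have th1_ge0 : 0 <= 1 - theta by rewrite subr_ge0.
have A1 := ler_wpM2l th_ge0 model_err.
have A2 := ler_wpM2l th1_ge0 infeas.
have A3 := ler_piMl kT_ge0 th_le1.
have A4 : (1 - theta) * (mu D * Delta_ e k T ^+ 2) <= mu D * Delta_ e k T ^+ 2.
  by rewrite ler_piMl // lerBlDr lerDl.
rewrite mulrDl; move: A1 A2 A3 A4; lra.
Qed.

(** The first entry comes from the drop when N_k < N, the second from the model decrease when N_k =
    N; their minimum is valid at every iteration. *)
Lemma Pred_ge k T : tried k T -> ~ rejects k T ->
  Num.min (eta D * (1 - r D) * h_min)
    (theta_min * (tau D * (2^-1 * eps_g * Num.min (Delta_ e k T) (eps_g / beta))))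
  <= Pred k T (theta_next k T).
Proof.
move=> tr nrej.
have [_ [_ _ /andP[eta_gt0 _] _ _]] := hD.
have : (Nk k <= N)%N by have /andP[] := Nk_bounds tr.1.
rewrite leq_eqVlt => /predU1P[NkN|NkN]; rewrite ge_min; apply/orP; [right|left].
  rewrite theta_next_full // Pred_theta_full //; last exact: tr.1.
  have theta_pos := theta_gt0 tr.1.
  apply: (@le_trans _ _ (theta_ e k * (tau D * (2^-1 * eps_g *
      Num.min (Delta_ e k T) (eps_g / beta))))).
    rewrite ler_wpM2r ?(theta_min_le tr.1) //.
    have [_ [_ _ _ /andP[tau_gt0 _] _]] := hD.
    rewrite mulr_ge0 ?(ltW tau_gt0) // mulr_ge0 //; first by rewrite mulr_ge0 // ltW.
    by rewrite le_min ltW ?(Delta_gt0 tr.1) //= divr_ge0 // ltW // beta_gt0.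
  by rewrite ler_pM2l // full_sample_decrease.
have [_] := theta_next_spec tr nrej; apply: le_trans.
by rewrite -mulrA ler_pM2l // (drop_partial tr.1).
Qed.

(* Below radius [rho], each hypothesis rules out one cause of a repetition:
   [rho_infeas] a rejection in Step 3 and a failed Step 5 test when N_k < N,
   [rho_eps] and [rho_opt] a failed Step 5 test when N_k = N. *)
Section SmallRadius.
Context (rho : R).
Hypothesis rho_gt0 : 0 < rho.
Hypothesis rho_infeas :
  kappa * rho ^+ 2 <= (1 - eta D) * (eta D * (1 - r D) * h_min).
Hypothesis rho_eps : rho <= eps_g / beta.
Hypothesis rho_opt : kappa * rho <= (1 - eta D) * (theta_min * (tau D * (2^-1 * eps_g))).

(** A rejection in Step 3 needs a proper trial sample after a full one, hence h(N - 1) <= mu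
    Delta^2, which is impossible for this radius. In Step 5, Pred - Ared <= kappa Delta^2 <= (1 -
    eta) Pred, so the test succeeds. *)
Lemma small_radius_no_repeat k T : reached k T -> Delta_ e k T <= rho ->
  ~ repeats k T.
Proof.
move=> hk Delta_le [nst rep].
have tr : tried k T by [].
have [_ [_ /andP[r_gt0 r_lt1] /andP[eta_gt0 eta_lt1] _ /andP[mu_ge0 _]]] := hD.
have Delta_pos := Delta_gt0 hk.
have hm := h_min_gt0.
have kap := kappa_gt0.
have D2 : Delta_ e k T ^+ 2 <= rho ^+ 2.
  by rewrite ler_sqr ?nnegrE // ltW // (lt_le_trans Delta_pos).
have nrej : ~ rejects k T.
  move=> [NkN sN _].
  have s1 := run_step1 run (reached_start hk).
  have NtN : Ntilde_ e k = N by move: s1; rewrite /step1 NkN ltnn.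
  have [/andP[s_gt0 _] _] := run_sample run hk.
  have h_le : h_min <= h (Nnext k T) by apply: infeasibility_ge_pred; rewrite ?s_gt0.
  have := sample_infeasibility hk; rewrite NtN h_N subr0 => h_mu.
  have mu_le : mu D * Delta_ e k T ^+ 2 <= kappa * rho ^+ 2.
    apply: ler_pM => //; first exact: sqr_ge0.
    by rewrite lerDr /kappaT; move: (kappaB_gt0) (L_ge0); lra.
  have : (1 - eta D) * (eta D * (1 - r D) * h_min) < h_min.
    have a1 : (1 - eta D) * (eta D * (1 - r D)) < 1.
      have a2 : eta D * (1 - r D) < 1 by nra.
      have a3 : 0 < eta D * (1 - r D) by rewrite mulr_gt0 ?subr_gt0.
      nra.
    by rewrite mulrA -[ltRHS]mul1r ltr_pM2r.
  by move: rho_infeas mu_le h_mu h_le; lra.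
case: rep => // ntest; apply: ntest; rewrite /step5_test.
have [/andP[th_gt0 th_le] _] := theta_next_spec tr nrej.
have th1 : 0 <= theta_next k T <= 1.
  by rewrite ltW //= (le_trans th_le (theta_le1 hk)).
have gap := Pred_sub_Ared tr th1.
have := Pred_ge tr nrej.
(* By [rho_eps] the radius is the smaller entry, so the full-sample bound is linear in Delta whereas
   the error is quadratic. *)
rewrite (min_idPl (le_trans Delta_le rho_eps)) => pred_ge.
suff : kappa * Delta_ e k T ^+ 2 <= (1 - eta D) * Pred k T (theta_next k T).
  by move: gap; lra.
have eta1 : 0 < 1 - eta D by rewrite subr_gt0.
apply: (le_trans _ (ler_wpM2l (ltW eta1) pred_ge)).
rewrite (minr_pMr _ _ (ltW eta1)) le_min; apply/andP; split.
  by apply: le_trans rho_infeas; rewrite ler_pM2l.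
have k1 : kappa * Delta_ e k T <= kappa * rho by rewrite ler_pM2l.
have := ler_wpM2r (ltW Delta_pos) (le_trans k1 rho_opt).
lra.
Qed.

(** Only a repetition shrinks the radius, by the factor [zeta1 D], and it occurs only above [rho];
    acceptance never shrinks it. *)
Lemma Delta_lower_bound (d : R) : d <= Delta_init D -> d <= zeta1 D * rho ->
  forall k T, reached k T -> d <= Delta_ e k T.
Proof.
move=> d_init d_rho k T.
have [[_ _ _ /andP[zeta1_gt0 zeta1_lt1] _] _] := hD.
elim=> {k T} [|k T hk IH rep|k T hk IH acc].
- by rewrite (run_Delta0 run).
- rewrite (run_repeat run hk rep) (le_trans d_rho) // ler_pM2l //.
  by rewrite leNgt; apply/negP => /ltW /(small_radius_no_repeat hk).
- by have [_ _ _ /andP[+ _]] := run_accept run hk acc; exact: le_trans.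
Qed.

(** Endless repetition would make the radius a geometric sequence tending to 0, and below [rho]
    there are no repetitions. *)
Lemma iteration_ends k : reached k 0 ->
  exists2 T, reached k T & stops k T \/ accepts k T.
Proof.
move=> hk; apply: contrapT => no_end.
have [[_ _ Delta0_gt0 /andP[zeta1_gt0 zeta1_lt1] _] _] := hD.
have all_repeat T : reached k T -> repeats k T.
  move=> hT; have nst : ~ stops k T by move=> st; apply: no_end; exists T; [|left].
  split=> //; apply: contrapT => /not_orP[nrej ntest]; apply: no_end.
  by exists T => //; right; split=> //; exact: contrapT.
have all_reached T : reached k T.
  by elim: T => // T hT; exact: reached_repeat (all_repeat T hT).
have Delta_eq T : Delta_ e k T = Delta_ e k 0 * zeta1 D ^+ T.
  elim: T => [|T IH]; first by rewrite expr0 mulr1.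
  by rewrite (run_repeat run (all_reached T) (all_repeat T _)) // IH exprS mulrCA.
have Delta_cvg : geometric (Delta_ e k 0) (zeta1 D) @ \oo --> 0.
  by apply: cvg_geometric; rewrite gtr0_norm.
have /cvgr0Pnorm_lt/(_ rho rho_gt0)[T _ /(_ T (leqnn T))] := Delta_cvg.
rewrite /= -Delta_eq gtr0_norm ?(Delta_gt0 (all_reached T)) // => /ltW.
by move=> /(small_radius_no_repeat (all_reached T)); apply; exact: all_repeat.
Qed.

End SmallRadius.

(** * Merit function, telescoping and the iteration count *)

Section Merit.
Context (M : R).
Hypothesis favg_bound : forall k I, reached k 0 -> `|favg phi I (x_ e k)| <= M.

Definition merit k : R :=
  theta_ e k * favg phi (I_ e k) (x_ e k) + (1 - theta_ e k) * h (Nk k).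

(* The extra term pays for the change of the merit function when theta decreases:
   (theta_k - theta_{k+1}) (h(N_k) - f) <= (theta_k - theta_{k+1}) (M + h(1)). *)
Definition potential k : R := merit k + (M + h 1%N) * theta_ e k.

Lemma potential_decrease k T : reached k T -> accepts k T ->
  eta D * Pred k T (theta_next k T) <= potential k - potential k.+1.
Proof.
move=> hk acc; have hk0 := reached_start hk.
have [xE IE thE _] := run_accept run hk acc.
have [nst nrej] := acc; rewrite /step5_test => test.
have [/andP[_ th_le] _] := theta_next_spec (conj hk nst) nrej.
have f_ge := favg_bound (I_ e k) hk0; rewrite ler_norml in f_ge.
have /andP[Nk_gt0 _] := Nk_bounds hk.
have h_le : h (Nk k) <= h 1%N by exact: decreasing_le.
apply: le_trans test _; rewrite /Defs.Ared /potential /merit thE xE.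
rewrite /Defs.Nk /Defs.Nnext IE -/(Nk k).
set th' := theta_next k T in th_le *.
(* At the fixed weight [th'] the merit drops by exactly Ared; this inequality absorbs the change of
   weight. *)
have : (theta_ e k - th') * (h (Nk k) - favg phi (I_ e k) (x_ e k))
    <= (theta_ e k - th') * (M + h 1%N).
  by rewrite ler_wpM2l ?subr_ge0 //; case/andP: f_ge; move: h_le; lra.
lra.
Qed.

(** The merit is a convex combination of a value in [-M, M] and one in [0, h(1)], and the added term
    lies in [0, M + h(1)]. The width 3 (M + h(1)) bounds the total decrease. *)
Lemma potential_range k : reached k 0 ->
  - (M + h 1%N) <= potential k <= 2 * (M + h 1%N).
Proof.
move=> hk.
have th_ge0 := ltW (theta_gt0 hk); have th_le1 := theta_le1 hk.
have := favg_bound (I_ e k) hk; rewrite ler_norml => /andP[f_ge f_le].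
have NkN := Nk_bounds hk; have /andP[Nk_gt0 _] := NkN.
have h_le : h (Nk k) <= h 1%N by exact: decreasing_le.
have h_ge0 : 0 <= h (Nk k) by exact: infeasibility_ge0 NkN.
rewrite /potential /merit.
set f := favg _ _ _ in f_ge f_le *; set t := theta_ e k in th_ge0 th_le1 *.
set H := h (Nk k) in h_le h_ge0 *.
apply/andP; split; nra.
Qed.

Lemma potential_total (delta : R) :
  (forall k T, reached k T -> accepts k T ->
    delta <= eta D * Pred k T (theta_next k T)) ->
  forall k, reached k 0 -> k%:R * delta <= potential 0 - potential k.
Proof.
move=> step_ge; elim=> [|k IH hk]; first by rewrite mul0r subrr.
have [T hT acc] := reachedS hk.
have := IH (reached_start hT); have := step_ge _ _ hT acc.
have := potential_decrease hT acc.
rewrite -natr1 mulrDl mul1r; lra.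
Qed.

End Merit.

(** Without a stop in iterations 0 to m - 1, each of them accepts a step, and the potential would
    fall by m delta, more than its range. A stop at index k < m counts as iteration k + 1 <= m. *)
Lemma run_terminates (M rho delta : R) (m : nat) :
  (forall k I, reached k 0 -> `|favg phi I (x_ e k)| <= M) ->
  0 < rho ->
  kappa * rho ^+ 2 <= (1 - eta D) * (eta D * (1 - r D) * h_min) ->
  rho <= eps_g / beta ->
  kappa * rho <= (1 - eta D) * (theta_min * (tau D * (2^-1 * eps_g))) ->
  (forall k T, reached k T -> accepts k T ->
    delta <= eta D * Pred k T (theta_next k T)) ->
  3 * (M + h 1%N) < m%:R * delta ->
  terminates_within phi h D eps_g e m.
Proof.
move=> favg_bound rho_gt0 rho_infeas rho_eps rho_opt step_ge m_large.
apply: contrapT => no_stop.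
have all_reached k : (k <= m)%N -> reached k 0.
  elim: k => [_|k IH km]; first exact: reached0.
  have [T hT [st|acc]] := iteration_ends rho_gt0 rho_infeas rho_eps rho_opt
    (IH (ltnW km)).
    by case: no_stop; exists k, T; split.
  exact: reached_accept hT acc.
have reached_m := all_reached m (leqnn m).
have := potential_total favg_bound step_ge reached_m.
have /andP[_] := potential_range favg_bound (all_reached 0%N (leq0n m)).
have /andP[+ _] := potential_range favg_bound reached_m.
by move: m_large; lra.
Qed.

End Run.

(** * Choice of constants independent of the accuracy, and the complexity bound *)

Unset Implicit Arguments.
Set Strict Implicit.

Theorem corollary5p3 (R : realType) (N n : nat) (hN : (1 <= N)%N)
    (hn : (1 <= n)%N) (phi : 'I_N -> 'rV[R]_n -> R)
    (hphi : forall i, C1 (phi i))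
    (h : nat -> R) (h_decr : strictly_decreasing h) (h_1 : 0 < h 1%N)
    (h_N : h N = 0)
    (D : iretr_data R n) (hD : valid_data N D) (hgamma : gamma D = 1)
    (Omega : set 'rV[R]_n) (hOmega : compact Omega)
    (L kappaB theta_low C : R) (hL : 0 <= L) (hkappaB : 0 < kappaB)
    (htheta_low : 0 < theta_low) :
  exists2 nu4 : R, 0 < nu4 &
    forall eps_g : R, 0 < eps_g ->
    (h N.-1)^-1 <= C * eps_g ^- 2 ->
    zeta1 D * Num.max (Gamma D L kappaB theta_low * eps_g)
                      (Num.sqrt (h N.-1 / mu D)) <= Delta_init D ->
    forall e : trace R n N,
    iretr_run phi h D eps_g e ->
    iterates_in phi h D eps_g e Omega ->
    gradients_lipschitz phi h D eps_g e L ->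
    hessians_bounded phi h D eps_g e kappaB ->
    theta_bounded_below phi h D eps_g e theta_low ->
    terminates_within phi h D eps_g e (Num.ceil (nu4 * eps_g ^- 2) + 1).
Proof.
(* N = 1 would give 0 < h(1) = h(N) = 0. *)
have N_gt1 : (1 < N)%N.
  rewrite ltn_neqAle hN andbT; apply/eqP => N1.
  by move: h_1; rewrite N1 h_N ltxx.
have dphi i y : differentiable (phi i) y by case: (hphi i).
have [M M_ge0 favgM] := favg_bounded_on_compact dphi hOmega.
have hmin_gt0 := h_min_gt0 h_decr h_N N_gt1.
have [C_le0|C_gt0] := leP C 0.
  (* no accuracy level satisfies the hypothesis on h(N - 1) *)
  exists 1 => // eps eps_gt0 C_ge; exfalso.
  have : C * eps ^- 2 <= 0 by rewrite mulr_le0_ge0 // invr_ge0 sqr_ge0.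
  by rewrite leNgt (lt_le_trans _ C_ge) // invr_gt0.
have [[_ _ _ /andP[z_gt0 z_lt1] _] [_ /andP[r_gt0 r_lt1] /andP[eta_gt0 eta_lt1]
  /andP[tau_gt0 _] /andP[mu_ge0 _]]] := hD.
have th_gt0 := theta_min_gt0 hD htheta_low.
have b_gt0 := beta_gt0 hkappaB.
have b_ge1 : 1 <= beta kappaB by rewrite /beta lerDl ltW.
have K_gt0 := kappa_gt0 hD hL hkappaB.
set K := kappaT L kappaB + mu D in K_gt0.
set th := theta_min _ _ in th_gt0.
set b := beta kappaB in b_gt0 b_ge1.
have eta1_gt0 : 0 < 1 - eta D by rewrite subr_gt0.
have r1_gt0 : 0 < 1 - r D by rewrite subr_gt0.
(* The radius [rho] will be c1 eps; the three entries yield [rho_eps], [rho_opt] and, through h(N -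
   1) >= eps^2 / C, [rho_infeas]. *)
pose c1 := Num.min b^-1 (Num.min ((1 - eta D) * (th * (tau D * 2^-1)) / K)
  ((1 - eta D) * (eta D * (1 - r D) / C) / K)).
have c1_gt0 : 0 < c1.
  by rewrite !lt_min invr_gt0 b_gt0 /= !(divr_gt0, mulr_gt0) // invr_gt0.
have c1_b : c1 <= b^-1 by rewrite /c1 ge_min lexx.
have c1_le1 : c1 <= 1 by rewrite (le_trans c1_b) // invf_le1.
have c1_opt : K * c1 <= (1 - eta D) * (th * (tau D * 2^-1)).
  by rewrite mulrC -ler_pdivlMr // /c1 !ge_min lexx !orbT.
have c1_infeas : K * c1 <= (1 - eta D) * (eta D * (1 - r D) / C).
  by rewrite mulrC -ler_pdivlMr // /c1 !ge_min lexx !orbT.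
have G_gt0 : 0 < Gamma D L kappaB theta_low.
  by rewrite /Gamma lt_min !(divr_gt0, mulr_gt0).
(* c eps will bound every radius from below: [c1] handles reductions starting above [rho], and
   [Gamma] the initial radius. *)
pose c := zeta1 D * Num.min c1 (Gamma D L kappaB theta_low).
have c_gt0 : 0 < c by rewrite mulr_gt0 // lt_min c1_gt0.
(* c3 eps^2 will bound eta Pred at acceptance: this is [Pred_ge] with h(N - 1) >= eps^2 / C and
   Delta >= c eps inserted. *)
pose c3 := eta D * Num.min (eta D * (1 - r D) / C)
  (th * (tau D * (2^-1 * Num.min c b^-1))).
have c3_gt0 : 0 < c3.
  rewrite mulr_gt0 // lt_min !(divr_gt0, mulr_gt0) //=.
  by rewrite lt_min c_gt0 invr_gt0.
have K0_gt0 : 0 < 3 * (M + h 1%N) by rewrite mulr_gt0 // ltr_wpDl.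
exists (3 * (M + h 1%N) / c3); first by rewrite divr_gt0.
move=> eps eps_gt0 C_ge Delta0_ge e run iter lip hess theta_b.
have eps2_gt0 : 0 < eps ^+ 2 by rewrite exprn_gt0.
have eps2_le : eps ^+ 2 / C <= h N.-1.
  move: C_ge; rewrite ler_pdivlMr // mulrC ler_pdivrMr // mulrC.
  by rewrite ler_pdivrMr.
have ceil_ge0 : 0 <= Num.ceil (3 * (M + h 1%N) / c3 * eps ^- 2).
  rewrite -(ler_int R) (le_trans _ (ceil_ge _)) //.
  by rewrite ltW // mulr_gt0 ?invr_gt0 // divr_gt0.
(* The successor provides the strict inequality m > nu4 eps^-2 that the counting argument needs. *)
set m := `|Num.ceil (3 * (M + h 1%N) / c3 * eps ^- 2)|%N.+1.
have -> : Num.ceil (3 * (M + h 1%N) / c3 * eps ^- 2) + 1 = m%:Z.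
  by rewrite /m intS gez0_abs // addrC.
have rho_gt0 : 0 < c1 * eps by rewrite mulr_gt0.
have rho_infeas : K * (c1 * eps) ^+ 2
    <= (1 - eta D) * (eta D * (1 - r D) * h N.-1).
  (* Since c1 <= 1, c1^2 <= c1, so the bound on K c1 suffices. *)
  apply: (@le_trans _ _ (K * c1 * eps ^+ 2)).
    rewrite exprMn mulrA ler_wpM2r ?(ltW eps2_gt0) // ler_wpM2l ?(ltW K_gt0) //.
    by rewrite expr2 ler_piMl ?(ltW c1_gt0).
  apply: (le_trans (ler_wpM2r (ltW eps2_gt0) c1_infeas)).
  rewrite -!mulrA !(ler_pM2l eta1_gt0, ler_pM2l eta_gt0, ler_pM2l r1_gt0).
  by rewrite mulrC.
have rho_eps : c1 * eps <= eps / b by rewrite mulrC ler_wpM2l ?(ltW eps_gt0).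
have rho_opt : K * (c1 * eps) <= (1 - eta D) * (th * (tau D * (2^-1 * eps))).
  by have := ler_wpM2r (ltW eps_gt0) c1_opt; lra.
apply: (run_terminates dphi h_decr h_N N_gt1 hD hgamma hL hkappaB htheta_low
  eps_gt0 run lip hess theta_b (M := M) (delta := c3 * eps ^+ 2) _ rho_gt0) => //.
- by move=> k I /iter; exact: favgM.
- move=> k T hk acc; have [nst nrej _] := acc.
  have d_init : c * eps <= Delta_init D.
    apply: le_trans Delta0_ge; rewrite /c -mulrA ler_pM2l // le_max.
    by rewrite ler_pM2r // ge_min lexx orbT.
  have d_rho : c * eps <= zeta1 D * (c1 * eps).
    by rewrite /c -mulrA ler_pM2l // ler_pM2r // ge_min lexx.
  have Delta_ge : c * eps <= Delta_ e k T.
    exact: (Delta_lower_bound dphi h_decr h_N N_gt1 hD hgamma hL hkappaB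
      htheta_low eps_gt0 run lip hess theta_b rho_gt0 rho_infeas rho_eps rho_opt
      d_init d_rho hk).
  have := Pred_ge h_decr h_N N_gt1 hD hkappaB htheta_low eps_gt0 run hess theta_b
    (conj hk nst) nrej.
  rewrite -(ler_pM2l eta_gt0); apply: le_trans.
  rewrite /c3 -mulrA ler_pM2l // le_min -/th -/b; apply/andP; split.
    apply: (@le_trans _ _ (eta D * (1 - r D) / C * eps ^+ 2)).
      by rewrite ler_pM2r // ge_min lexx.
    by rewrite -mulrA ler_pM2l ?mulr_gt0 // mulrC.
  apply: (@le_trans _ _ (th * (tau D * (2^-1 * Num.min c b^-1)) * eps ^+ 2)).
    by rewrite ler_pM2r // ge_min lexx orbT.
  rewrite -!mulrA !(ler_pM2l th_gt0, ler_pM2l tau_gt0) ler_pM2l //.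
  rewrite expr2 mulrCA ler_pM2l // le_min; apply/andP; split.
    by apply: le_trans Delta_ge; rewrite ler_pM2r // ge_min lexx.
  by rewrite mulrC ler_pM2l // ge_min lexx orbT.
- have m_ge : 3 * (M + h 1%N) / c3 * eps ^- 2 < m%:R.
    rewrite (le_lt_trans (ceil_ge _)) // /m.
    by rewrite -[ltRHS]natr1 natr_absz ger0_norm // ltrDl.
  by move: m_ge; rewrite -mulrA -invfM ltr_pdivrMr ?(mulr_gt0 c3_gt0).
Qed.
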